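(* The preordered sets $(\mathcal{AN},\le_K)$ and $(\omega^\omega,\le^* )$ are Tukey equivalent.
   Context: Ideals on $\omega$ are proper and contain all finite sets. For an ideal $\mathcal{I}$, $\mathcal{I}^*=\{\omega\setminus A\colon A\in\mathcal{I}\}$ is the dual filter, and $N_{\mathcal{I}^*}=\omega\cup\{p\}$ is the space where points of $\omega$ are isolated and the sets $A\cup\{p\}$, $A\in\mathcal{I}^*$, form a neighborhood base at $p$. A zero-dimensional space $X$ has the finitely supported Nikodym property if every sequence of finitely supported real measures $\mu_n=\sum_{x\in F_n}\alpha_x\delta_x$ on $X$ ($F_n$ finite, norm $\sum|\alpha_x|$) with $\lim_n\mu_n(A)=0$ for every clopen $A\subseteq X$ is norm bounded. $\mathcal{AN}$ is the class of all ideals $\mathcal{I}$ on $\omega$ for which $N_{\mathcal{I}^*}$ does not have the finitely supported Nikodym property. Katětov order: $\mathcal{I}\le_K\mathcal{J}$ iff there is $f\colon\omega\to\omega$ with $f^{-1}[A]\in\mathcal{J}$ for all $A\in\mathcal{I}$. For $f,g\in\omega^\omega$, $f\le^*g$ iff $f(n)\le g(n)$ for all but finitely many $n$. A map $h\colon P\to Q$ between preorders is a Tukey reduction if for every $q_0\in Q$ there is $p_0\in P$ such that $h(p)\le q_0$ implies $p\le p_0$; $P\preceq_T Q$ if a Tukey reduction exists, and $P,Q$ are Tukey equivalent if $P\preceq_T Q$ and $Q\preceq_T P$. *)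

(* Defs.v *)
From HB Require Import structures.
From mathcomp Require Import all_boot all_order all_algebra finmap.
From mathcomp Require Import all_classical all_reals all_analysis.

Set Implicit Arguments.
Unset Strict Implicit.
Unset Printing Implicit Defensive.

Import Order.TTheory GRing.Theory Num.Theory.
Import numFieldNormedType.Exports.

Local Open Scope classical_set_scope.
Local Open Scope ring_scope.

Record preorder := Preorder {
  pcarrier :> Type;
  ple : pcarrier -> pcarrier -> Prop;
  ple_refl : forall x, ple x x;
  ple_trans : forall x y z, ple x y -> ple y z -> ple x z }.

Definition tukey_reduction (P Q : preorder) (h : P -> Q) : Prop :=
  forall q0 : Q, exists p0 : P, forall p : P, ple (h p) q0 -> ple p p0.

Definition tukey_le (P Q : preorder) : Prop :=
  exists h : P -> Q, tukey_reduction h.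

Definition tukey_equiv (P Q : preorder) : Prop :=
  tukey_le P Q /\ tukey_le Q P.

Definition le_star (f g : nat -> nat) : Prop :=
  finite_set [set n | ~ (f n <= g n)%N].

Lemma le_star_refl f : le_star f f.
Proof.
by apply: (sub_finite_set _ (@finite_set0 nat)) => n /=; rewrite leqnn.
Qed.

Lemma le_star_trans f g h : le_star f g -> le_star g h -> le_star f h.
Proof.
move=> fg gh; apply: (@sub_finite_set _ _ ([set n | ~ (f n <= g n)%N] `|`
  [set n | ~ (g n <= h n)%N])); last by rewrite finite_setU.
move=> n /= fhn; have [fgn|/negP] := boolP (f n <= g n)%N; last by left.
by right => ghn; apply: fhn; exact: leq_trans ghn.
Qed.

Definition baire_preorder : preorder :=
  Preorder le_star_refl le_star_trans.

Record ideal := Ideal {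
  ideal_sets :> set nat -> Prop;
  ideal_proper : ~ ideal_sets setT;
  ideal_finite : forall A, finite_set A -> ideal_sets A;
  ideal_sub : forall A B, A `<=` B -> ideal_sets B -> ideal_sets A;
  ideal_setU : forall A B,
    ideal_sets A -> ideal_sets B -> ideal_sets (A `|` B) }.

Definition dual_filter (I : ideal) : set_system nat :=
  [set ~` A | A in [set A | I A]].

Lemma dual_filterE (I : ideal) A : dual_filter I A <-> I (~` A).
Proof.
by split => [[B IB <-]|IA]; [rewrite setCK|exists (~` A); rewrite ?setCK].
Qed.

Lemma dual_filter_proper (I : ideal) : ProperFilter (dual_filter I).
Proof.
split; first by move/dual_filterE; rewrite setC0; exact: ideal_proper.
split.
- by apply/dual_filterE; rewrite setCT; apply: ideal_finite.
- move=> A B /dual_filterE IA /dual_filterE IB; apply/dual_filterE.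
  by rewrite setCI; exact: ideal_setU.
- move=> A B AB /dual_filterE IA; apply/dual_filterE.
  by apply: ideal_sub IA; exact: subsetC.
Qed.

(* The underlying set omega \cup {p} of N_{I^*}: [Some n] is the point n of
   omega and [None] is the point p. *)
Definition Nspace (I : ideal) : Type := option nat.

Section Nspace_topology.
Variable I : ideal.

HB.instance Definition _ := Choice.on (Nspace I).

Definition Nspace_nbhs (x : Nspace I) : set_system (Nspace I) :=
  match x with
  | Some n => [set U | U (Some n)]
  | None => [set U | exists2 A, dual_filter I A & None |` Some @` A `<=` U]
  end.

HB.instance Definition _ := hasNbhs.Build (Nspace I) Nspace_nbhs.

Lemma Nspace_nbhsNE (U : set (Nspace I)) :
  Nspace_nbhs None U <-> U None /\ dual_filter I [set n | U (Some n)].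
Proof.
have FF := dual_filter_proper I; split => [[A FA AU]|[UN FU]].
  split; first by apply: AU; left.
  by apply: filterS FA => n An; apply: AU; right; exists n.
by exists [set n | U (Some n)] => // x [->//|[n Un <-]].
Qed.

Let Nspace_nbhs_filter (x : Nspace I) : ProperFilter (nbhs x).
Proof.
have FF := dual_filter_proper I.
case: x => [n|].
  by split; [|split => // A B AB; exact: AB].
split; first by case/Nspace_nbhsNE.
split.
- by apply/Nspace_nbhsNE; split => //; exact: filterT.
- move=> A B /Nspace_nbhsNE[AN FA] /Nspace_nbhsNE[BN FB].
  by apply/Nspace_nbhsNE; split; [split|exact: filterI FA FB].
- move=> A B AB /Nspace_nbhsNE[AN FA].
  apply/Nspace_nbhsNE; split; first exact: AB.
  by apply: filterS FA => n; exact: AB.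
Qed.

Let Nspace_nbhs_singleton (x : Nspace I) (U : set (Nspace I)) :
  nbhs x U -> U x.
Proof. by case: x => [n//|/Nspace_nbhsNE[]]. Qed.

Let Nspace_nbhs_nbhs (x : Nspace I) (U : set (Nspace I)) :
  nbhs x U -> nbhs x (nbhs^~ U).
Proof.
case: x => [n//|UN]; apply/Nspace_nbhsNE; split => //.
by case/Nspace_nbhsNE: UN.
Qed.

HB.instance Definition _ := Nbhs_isNbhsTopological.Build (Nspace I)
  Nspace_nbhs_filter Nspace_nbhs_singleton Nspace_nbhs_nbhs.

End Nspace_topology.

(* Spaces N_{I^*} are zero-dimensional in the sense of having a base of clopen
   sets, and Hausdorff; [zero_dimensional] of the library only asserts that
   distinct points are separated by clopen sets. *)
Lemma Nspace_clopen_base (I : ideal) (x : Nspace I) (U : set (Nspace I)) :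
  nbhs x U -> exists V, [/\ clopen V, V x & V `<=` U].
Proof.
have FF := dual_filter_proper I.
have clN (V : set (Nspace I)) : V None -> nbhs (None : Nspace I) V -> clopen V.
  move=> VN nV; split; first by rewrite openE => -[].
  by rewrite -openC openE => -[n//|/(_ VN)].
case: x => [n Un|nU].
  exists [set Some n]; split => //; last by move=> _ ->.
  rewrite -[X in clopen X]setCK; apply: (@clopenC _ _ set0); apply: clN => //.
  apply/Nspace_nbhsNE; split => //; apply/dual_filterE.
  apply: ideal_finite; apply: (@sub_finite_set _ _ [set n]) => //.
  by move=> m /= /contrapT [].
by exists U; split => //; [apply: clN => //|]; exact: (nbhs_singleton nU).
Qed.

Lemma Nspace_zero_dimensional (I : ideal) : zero_dimensional (Nspace I).
Proof.
move=> x y xy; suff : nbhs x (~` [set y]).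
  move/Nspace_clopen_base => [V [cV Vx Vy]]; exists V; split => //.
  by move/Vy; apply.
case: x xy => [n|] xy; first by move/eqP: xy.
apply/Nspace_nbhsNE; split; first by move/eqP: xy.
apply/dual_filterE/ideal_finite; case: y xy => [m|//] _.
by apply: (@sub_finite_set _ _ [set m]) => // k /= /contrapT [].
Qed.

(* \sum_(x in F) alpha_x delta_x; the values of [fs_coef] outside [fs_dom] are
   irrelevant. *)
Record fs_measure (R : realType) (X : choiceType) := FsMeasure {
  fs_dom : {fset X};
  fs_coef : X -> R }.

Definition fs_eval (R : realType) (X : choiceType) (mu : fs_measure R X)
    (A : set X) : R :=
  \sum_(x <- fs_dom mu) fs_coef mu x * \1_A x.

Definition fs_norm (R : realType) (X : choiceType) (mu : fs_measure R X) : R :=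
  \sum_(x <- fs_dom mu) `|fs_coef mu x|.

Definition fs_nikodym (R : realType) (X : topologicalType) : Prop :=
  forall mu : nat -> fs_measure R X,
    (forall A : set X, clopen A -> fs_eval (mu n) A @[n --> \oo] --> 0) ->
    exists M : R, forall n, fs_norm (mu n) <= M.

Definition katetov_le (I J : ideal) : Prop :=
  exists f : nat -> nat, forall A, I A -> J (f @^-1` A).

Lemma katetov_le_refl I : katetov_le I I.
Proof. by exists id. Qed.

Lemma katetov_le_trans I J K :
  katetov_le I J -> katetov_le J K -> katetov_le I K.
Proof. by move=> [f fIJ] [g gJK]; exists (f \o g) => A /fIJ/gJK. Qed.

Definition AN (R : realType) : Type :=
  {I : ideal | ~ fs_nikodym R (Nspace I)}.

Definition AN_le (R : realType) (I J : AN R) : Prop :=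
  katetov_le (sval I) (sval J).

Lemma AN_le_refl (R : realType) (I : AN R) : AN_le I I.
Proof. exact: katetov_le_refl. Qed.

Lemma AN_le_trans (R : realType) (I J K : AN R) :
  AN_le I J -> AN_le J K -> AN_le I K.
Proof. exact: katetov_le_trans. Qed.

Definition AN_preorder (R : realType) : preorder :=
  Preorder (@AN_le_refl R) (@AN_le_trans R).

(* Main.v *)
(* An ideal I is in AN iff there are finitely supported nonnegative measures
   lambda_k on omega with lambda_k(A) -> 0 for every A in I and with lambda_k of
   mass as large as we please: restrict the given measures to omega and pass to
   variations by a gliding hump argument.  The sizes s_k of their supports are
   the function attached to I.

   Conversely f in omega^omega gives an ideal I_f: split (part of) omega into
   blocks Q_n of n^2 L(n) points, where L(n) > f(0) + ... + f(n), let kappa_n be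
   the uniform measure of mass n on Q_n, and put A in I_f iff kappa_n(A) -> 0.

   If s_k <= g(k) for almost all k and lambda_k has mass at least 2k, then
   Q_k is large enough to be mapped to the support of lambda_k so that the image
   of kappa_k is at most lambda_k, whence I <=_K I_g.

   If phi witnesses I_f <=_K J and s_k < f(k) infinitely often for measures
   lambda_k of mass at least 2 + (k+1)(k^2+1) attached to J, consider the images
   nu_k of the lambda_k under phi.  Either nu_k has mass at least 1 on the blocks
   beyond k, where its support meets each Q_n in at most f(k) <= L(n) points, or
   it has mass at least 1 on one of the at most (k+1)k^2 pieces of L(n) points
   into which the earlier blocks split.  In both cases the set has
   kappa_n-measure at most 1/n for all n, and a union of infinitely many such
   sets with disjoint block ranges is in I_f, although nu_k does not vanish on
   it. *)

Require Import Defs.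
From mathcomp Require Import all_boot all_order all_algebra finmap zify lra.
From mathcomp Require Import all_classical all_reals all_analysis.

Set Implicit Arguments.
Unset Strict Implicit.
Unset Printing Implicit Defensive.

Import Order.TTheory GRing.Theory Num.Theory.
Import numFieldNormedType.Exports.

Local Open Scope classical_set_scope.
Local Open Scope ring_scope.

(** * The ideal $I_f$ of sets with vanishing block masses *)

Section BlockIdeal.
Variable f : nat -> nat.

(** Summing up to n makes [width n] bound every [f k] with k <= n, so a set of [f k] points is small
    in all blocks from k on. The successor keeps it positive. *)
Definition width (n : nat) : nat := (\sum_(k < n.+1) f k).+1.

Lemma le_width (k n : nat) : (k <= n)%N -> (f k <= width n)%N.
Proof.
move=> kn; have kn1 : (k < n.+1)%N by [].
by rewrite /width (bigD1 (Ordinal kn1)) //=; lia.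
Qed.

Lemma width_gt0 n : (0 < width n)%N. Proof. by []. Qed.

Definition block (n : nat) : seq nat :=
  [seq choice.pickle (n, j) | j : nat <- iota 0 (n ^ 2 * width n)].

Definition block_index (x : nat) : nat :=
  if (choice.unpickle x : option (nat * nat)) is Some nj then nj.1 else 0%N.

Lemma block_index_pickle (n j : nat) : block_index (choice.pickle (n, j)) = n.
Proof. by rewrite /block_index choice.pickleK. Qed.

Lemma mem_block_index n x : x \in block n -> block_index x = n.
Proof. by case/mapP => j _ ->; exact: block_index_pickle. Qed.

Lemma size_block n : size (block n) = (n ^ 2 * width n)%N.
Proof. by rewrite size_map size_iota. Qed.

Lemma block_uniq n : uniq (block n).
Proof.
rewrite map_inj_uniq ?iota_uniq // => i j ij.
by case: (pcan_inj (@choice.pickleK _) ij).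
Qed.

Definition block_count (n : nat) (A : set nat) : nat :=
  count (fun x => x \in A) (block n).

Lemma sub_block_count n A B : A `<=` B -> (block_count n A <= block_count n B)%N.
Proof. by move=> AB; apply: sub_count => x; rewrite !inE; exact: AB. Qed.

Lemma block_countU n A B :
  (block_count n (A `|` B) <= block_count n A + block_count n B)%N.
Proof.
rewrite /block_count -count_predUI (leq_trans _ (leq_addr _ _)) //.
by apply: sub_count => x /=; rewrite in_setU.
Qed.

Lemma block_countC n A :
  (block_count n A + block_count n (~` A) = n ^ 2 * width n)%N.
Proof.
rewrite -size_block -(count_predC (fun x => x \in A) (block n)).
by congr addn; apply: eq_count => x /=; rewrite in_setC.
Qed.

Lemma block_count0 n A :
  (forall x, A x -> block_index x <> n) -> block_count n A = 0%N.
Proof.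
move=> An; apply/eqP; rewrite -leqn0 leqNgt -has_count; apply/hasPn => x xn.
by rewrite notin_setE => /An; apply; exact: mem_block_index.
Qed.

Lemma block_count_le_size n A (s : seq nat) :
  (forall x, A x -> x \in block n -> x \in s) -> (block_count n A <= size s)%N.
Proof.
move=> As; rewrite /block_count -size_filter; apply: uniq_leq_size.
  exact/filter_uniq/block_uniq.
by move=> x; rewrite mem_filter => /andP[/set_mem]; exact: As.
Qed.

(* With e ranging over nat, this says that the uniform measure of mass n on
   [block n] of A tends to 0. *)
Definition block_null (A : set nat) : Prop :=
  forall e, exists N, forall n, (N <= n)%N ->
    (e * block_count n A <= n * width n)%N.

Lemma block_null_proper : ~ block_null setT.
Proof.
(* The full block has n^2 [width n] points, which exceeds n [width n] once n >= 2. *)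
move=> /(_ 1%N)[N /(_ (maxn N 2))]; rewrite leq_maxl => /(_ isT).
have := block_countC (maxn N 2) setT.
rewrite setCT (@block_count0 _ set0) // addn0 => ->.
have := leq_maxr N 2; have := width_gt0 (maxn N 2).
by move: (maxn N 2) => m; move: (width m) => w; nia.
Qed.

Lemma block_null_low m A :
  (forall n x, (m <= n)%N -> A x -> x \notin block n) -> block_null A.
Proof.
move=> Am e; exists m => n mn; suff -> : block_count n A = 0%N by rewrite muln0.
apply/eqP; rewrite -leqn0 leqNgt -has_count; apply/hasPn => x xn.
by rewrite notin_setE => /(Am _ _ mn); rewrite xn.
Qed.

Lemma finite_nat_bound (A : set nat) (g : nat -> nat) :
  finite_set A -> exists m, forall x, A x -> (g x < m)%N.
Proof.
case/finite_seqP => s ->; exists (\max_(x <- s) g x).+1 => x /= xs.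
by rewrite ltnS; exact: leq_bigmax_seq.
Qed.

Lemma block_null_finite A : finite_set A -> block_null A.
Proof.
case/(finite_nat_bound block_index) => m Am.
apply: (@block_null_low m) => n x mn /Am; apply: contraTN => /mem_block_index ->.
by rewrite -leqNgt.
Qed.

Lemma block_null_sub A B : A `<=` B -> block_null B -> block_null A.
Proof.
move=> AB nB e; have [N HN] := nB e; exists N => n /HN.
by apply: leq_trans; rewrite leq_mul2l sub_block_count ?orbT.
Qed.

Lemma block_nullU A B : block_null A -> block_null B -> block_null (A `|` B).
Proof.
move=> nA nB e; have [N HN] := nA (2 * e)%N; have [M HM] := nB (2 * e)%N.
exists (maxn N M) => n; rewrite geq_max => /andP[/HN An /HM Bn].
by have := block_countU n A B; nia.
Qed.

(** Such a set has mass at most 1/n in block n, so the threshold for e is e itself. *)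
Lemma block_null_small A :
  (forall n, (block_count n A <= width n)%N) -> block_null A.
Proof. by move=> Aw e; exists e => n en; exact: leq_mul. Qed.

Definition block_ideal : ideal :=
  Ideal block_null_proper block_null_finite block_null_sub block_nullU.

End BlockIdeal.

(** * Null sequences and clopen subsets of $N_{I^*}$ *)

Lemma cvgn0P (R : realType) (u : nat -> R) :
  u n @[n --> \oo] --> 0 <->
  forall e : R, 0 < e -> exists N, forall n, (N <= n)%N -> `|u n| < e.
Proof.
rewrite cvgr0Pnorm_lt; split => H e e0; have := H e e0.
  by case=> N _ HN; exists N.
by case=> N HN; exists N.
Qed.

Section NspaceClopen.
Variable I : ideal.
Implicit Type A : set (Nspace I).

Lemma clopen_idealN A : clopen A -> ~ A None -> I [set n | A (Some n)].
Proof.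
case=> _; rewrite -openC openE => /(_ None) AN nA.
by have [_ /dual_filterE] := (Nspace_nbhsNE _).1 (AN nA); rewrite setCK.
Qed.

Lemma clopen_idealC A : clopen A -> A None -> I [set n | ~ A (Some n)].
Proof.
by move=> /clopenC-/(_ setT) cA AN; apply: (clopen_idealN cA); apply.
Qed.

Lemma clopen_image_Some (B : set nat) :
  I B -> clopen (Some @` B : set (Nspace I)).
Proof.
move=> IB; split; first by rewrite openE => -[n//|[]].
rewrite -openC openE => -[n//|_]; apply/Nspace_nbhsNE; split; first by case.
apply/dual_filterE; apply: ideal_sub IB => n /= /contrapT[m Bm [<-]]; exact: Bm.
Qed.

End NspaceClopen.

(** * Signed block measures showing that $I_f$ is in AN *)

Section BlockMeasure.
Variables (R : realType) (f : nat -> nat).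
Local Notation I := (block_ideal f).

Definition point_mass (n : nat) : R := (n * width f n)%:R^-1.

(** The atom -n at p balances the mass n of the block, so that clopen sets containing p also get
    small values. *)
Definition block_measure (n : nat) : fs_measure R (Nspace I) :=
  FsMeasure [fset x in (None :: map Some (block f n) : seq (Nspace I))]%fset
    (fun x => if x is Some _ then point_mass n else - n%:R).

Lemma sum_block_measure n (F : Nspace I -> R) :
  \sum_(x <- fs_dom (block_measure n)) F x =
  F None + \sum_(x <- block f n) F (Some x).
Proof.
rewrite (perm_big (None :: map Some (block f n))); last first.
  apply: uniq_perm; first exact: fset_uniq.
    rewrite cons_uniq map_inj_uniq ?block_uniq ?andbT; last by move=> x y [].
    by apply/mapP => -[].
  by move=> x; rewrite !inE.
by rewrite big_cons big_map.
Qed.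

Lemma block_measureE n (A : set (Nspace I)) :
  fs_eval (block_measure n) A =
  - n%:R * \1_A None + point_mass n * (block_count f n [set x | A (Some x)])%:R.
Proof.
rewrite /fs_eval sum_block_measure /=; congr (_ + _).
rewrite -mulr_sumr; congr (_ * _); rewrite /block_count -sum1_count natr_sum.
rewrite [RHS]big_mkcond /=; apply: eq_bigr => x _.
rewrite indicE (_ : (Some x \in A) = (x \in [set x | A (Some x)])).
  by case: ifP.
by apply/idP/idP; rewrite !inE.
Qed.

Lemma point_mass_block n : (0 < n)%N ->
  point_mass n * (n ^ 2 * width f n)%:R = n%:R.
Proof.
move=> n0; rewrite /point_mass -mulnn -mulnA (natrM _ n (n * _)) mulrCA mulVf ?mulr1 //.
by rewrite pnatr_eq0 muln_eq0 negb_or -!lt0n n0.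
Qed.

Lemma point_mass_null B : block_null f B ->
  forall e, 0 < e -> exists N, forall n, (N <= n)%N ->
    point_mass n * (block_count f n B)%:R < e.
Proof.
move=> nB e e0; have [N HN] := nB (Num.truncn e^-1).+1.
(* The successor forces n > 0, hence a nonzero denominator in [point_mass n]. *)
exists N.+1 => n Nn; have {}HN := HN n (ltnW Nn).
have nw : (0 < n * width f n)%N by rewrite muln_gt0 width_gt0 andbT; lia.
rewrite /point_mass mulrC ltr_pdivrMr ?ltr0n //.
have [->|c0] := posnP (block_count f n B); first by rewrite mulr_gt0 ?ltr0n.
have K1 : 1 < e * (Num.truncn e^-1).+1%:R.
  by rewrite -[ltLHS](mulfV (lt0r_neq0 e0)) ltr_pM2l // truncnS_gt.
apply: (@lt_le_trans _ _ (e * ((Num.truncn e^-1).+1 * block_count f n B)%:R)).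
  by rewrite natrM mulrA ltr_pMl // ltr0n.
by rewrite ler_pM2l // ler_nat.
Qed.

Lemma block_ideal_AN : ~ fs_nikodym R (Nspace I).
Proof.
move=> /(_ block_measure)[A cA|M].
  apply/cvgn0P => e e0; have [AN|AN] := pselect (A None).
    have [N HN] := point_mass_null (clopen_idealC cA AN) e0.
    exists N.+1 => n Nn; rewrite block_measureE indicE mem_set // mulr1.
    (* With n written as the mass of the whole block, the value at A becomes minus the mass of the
       complement, which is in the ideal. *)
    rewrite -[X in - X](@point_mass_block n); last by lia.
    rewrite -(block_countC f n [set x | A (Some x)]) natrD mulrDr opprD.
    rewrite addrAC addNr add0r normrN ger0_norm ?HN //; first exact: ltnW.
    by rewrite mulr_ge0 ?invr_ge0.
  have [N HN] := point_mass_null (clopen_idealN cA AN) e0.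
  exists N => n Nn; rewrite block_measureE indicE memNset // mulr0 add0r.
  by rewrite ger0_norm ?HN // mulr_ge0 ?invr_ge0.
apply/existsNP; exists (Num.truncn M).+1; apply/negP; rewrite -ltNge.
rewrite /fs_norm sum_block_measure /= normrN normr_nat.
by rewrite (lt_le_trans (truncnS_gt _)) // lerDl sumr_ge0.
Qed.

End BlockMeasure.

(** * Gliding humps *)

(** Iterate a choice function for the hypothesis from 0, each stage starting where the previous one
    stopped. The rank r is the identity in the argument on variations and [block_index] in the lower
    bound. *)
Lemma gliding_hump (r : nat -> nat) (Q : nat -> nat -> set nat -> nat -> Prop) :
  (forall m, exists k B m', [/\ (m <= k)%N, (m < m')%N,
    forall x, B x -> (m <= r x < m')%N & Q m k B m']) ->
  exists (m_ k_ : nat -> nat) (B_ : nat -> set nat), [/\ forall j, (j <= k_ j)%N,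
    forall i j, (i <= j)%N -> (m_ i <= m_ j)%N,
    forall j x, B_ j x -> (m_ j <= r x < m_ j.+1)%N &
    forall j, Q (m_ j) (k_ j) (B_ j) (m_ j.+1)].
Proof.
move=> step.
have [F HF] := @choice nat (nat * set nat * nat)%type
  (fun m t => [/\ (m <= t.1.1)%N, (m < t.2)%N,
    forall x, t.1.2 x -> (m <= r x < t.2)%N & Q m t.1.1 t.1.2 t.2])
  (fun m => let: ex_intro k (ex_intro B (ex_intro m' H)) := step m in
    ex_intro _ (k, B, m') H).
pose m_ j := iter j (fun m => (F m).2) 0%N.
have mS j : (m_ j < m_ j.+1)%N by have [] := HF (m_ j).
have mj j : (j <= m_ j)%N.
  by elim: j => // j IH; exact: leq_ltn_trans (mS j).
exists m_, (fun j => (F (m_ j)).1.1), (fun j => (F (m_ j)).1.2); split.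
- by move=> j; have [jk _ _ _] := HF (m_ j); exact: leq_trans jk.
- apply: (@homo_leq _ m_ (fun a b => (a <= b)%N)) => //.
    by move=> ? ? ?; exact: leq_trans.
  by move=> j; exact: ltnW.
- by move=> j x Bx; have [_ _ + _] := HF (m_ j); exact.
- by move=> j; have [] := HF (m_ j).
Qed.

Lemma seq_nat_bound (s : seq nat) (r : nat -> nat) :
  exists m, forall x, x \in s -> (r x < m)%N.
Proof.
by apply: (finite_nat_bound r); exact: (finite_seq s).
Qed.

(** * Weighted sums over finite lists, and passage from signed sums to variations *)

Section WeightedSums.
Variable R : realType.
Implicit Types (P : seq nat) (w : nat -> R) (A B : set nat).

Definition wsum P w A : R := \sum_(x <- P | x \in A) w x.

Lemma wsum_ge0 P w A : (forall x, 0 <= w x) -> 0 <= wsum P w A.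
Proof. by move=> w0; exact: sumr_ge0. Qed.

Lemma wsumT P w : wsum P w setT = \sum_(x <- P) w x.
Proof. by apply: eq_bigl => x; rewrite in_setT. Qed.

Lemma le_wsum P w A B : (forall x, 0 <= w x) ->
  (forall x, x \in P -> A x -> B x) -> wsum P w A <= wsum P w B.
Proof.
move=> w0 AB; rewrite /wsum big_mkcond [leRHS]big_mkcond /=.
rewrite big_seq [leRHS]big_seq; apply: ler_sum => x xP.
case: ifP => [/set_mem Ax|_]; last by case: ifP.
by rewrite mem_set //; exact: AB.
Qed.

Lemma le_wsumU P w A B : (forall x, 0 <= w x) ->
  wsum P w (A `|` B) <= wsum P w A + wsum P w B.
Proof.
move=> w0; rewrite /wsum big_mkcond /= [X in _ <= X + _]big_mkcond /=.
rewrite [X in _ <= _ + X]big_mkcond /= -big_split /=; apply: ler_sum => x _.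
rewrite in_setU; have := w0 x.
by case: (x \in A); case: (x \in B) => /= wx; lra.
Qed.

(** Repeated occurrences of m all carry the same weight, so nothing cancels. *)
Lemma wsum_norm1 P w m : wsum P (fun x => `|w x|) [set m] = `|wsum P w [set m]|.
Proof.
rewrite /wsum (eq_bigr (fun=> `|w m|)); last by move=> x; rewrite inE => ->.
rewrite [in RHS](eq_bigr (fun=> w m)); last by move=> x; rewrite inE => ->.
by rewrite !big_const_seq !iter_addr !addr0 normrMn.
Qed.

Section Schur.
Variables (I : ideal) (P : nat -> seq nat) (w : nat -> nat -> R).
Hypothesis wsum_cvg0 : forall A, I A -> wsum (P n) (w n) A @[n --> \oo] --> 0.

Local Notation abs n := (wsum (P n) (fun x => `|w n x|)).

(** Singletons are in I, and on a singleton the variation is the absolute value of the signed sum;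
    add up the points below m. *)
Lemma wsum_norm_initial_cvg0 m : abs n `I_m @[n --> \oo] --> 0.
Proof.
apply/cvgn0P; elim: m => [|m IH] e e0.
  by exists 0%N => n _; rewrite II0 /wsum big_pred0 ?normr0 // => x; rewrite in_set0.
have e20 : 0 < e / 2 by lra.
have [N HN] := IH _ e20.
have [M HM] := (cvgn0P _).1 (wsum_cvg0 (ideal_finite I (finite_set1 m))) _ e20.
exists (maxn N M) => n; rewrite geq_max => /andP[/HN An /HM Bn].
have := le_wsumU (P n) `I_m [set m] (fun x => normr_ge0 (w n x)).
rewrite -IIS wsum_norm1.
have abs0 B : `|abs n B| = abs n B by rewrite ger0_norm ?wsum_ge0.
by move: An; rewrite !abs0 => An; lra.
Qed.

(* If the variation of [w n] on [A] does not vanish, then a union of finite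
   pieces of constant sign of [A], far apart from each other, is a set in [I]
   on which the signed sums do not vanish either. *)
Lemma wsum_norm_cvg0 A : I A -> abs n A @[n --> \oo] --> 0.
Proof.
move=> IA; apply/cvgn0P => e e0; apply: contrapT => /forallNP notcvg.
have e80 : 0 < e / 8 by lra.
(* If the variation on A is at least e and that below m is under e/8, then the positive or the
   negative part carries at least 3e/8. An error below e/8 from the other humps still leaves more
   than e/8. *)
pose Q m k (B : set nat) m' := [/\ B `<=` A, forall x, x \in P k -> (x < m')%N,
  abs k `I_m < e / 8 & e * 3 / 8 <= `|wsum (P k) (w k) B|].
have [m|m_ [k_ [B_ [jk m_le B_m HQ]]]] := @gliding_hump id Q.
  have [N HN] := (cvgn0P _).1 (wsum_norm_initial_cvg0 m) _ e80.
  have [k /not_implyP[]] := (existsNP _).2 (notcvg (maxn N m)).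
  rewrite geq_max => /andP[Nk mk] /negP; rewrite -leNgt => ek.
  have [m' Pm'] := seq_nat_bound (P k) id.
  pose C s := [set x | [/\ A x, (m <= x)%N, x \in P k & (0 <= w k x) = s]].
  have Ck s : wsum (P k) (fun x => `|w k x|) (C s) = `|wsum (P k) (w k) (C s)|.
    rewrite -[LHS]ger0_norm ?wsum_ge0 //.
    have -> : wsum (P k) (fun x => `|w k x|) (C s) =
        (if s then 1 else -1) * wsum (P k) (w k) (C s).
      rewrite /wsum mulr_sumr; apply: eq_bigr => x; rewrite inE => -[_ _ _].
      case: s => [w0|/negbT]; first by rewrite mul1r ger0_norm.
      by rewrite -ltNge mulN1r => w0; rewrite ltr0_norm.
    by rewrite normrM; case: (s); rewrite ?normrN normr1 mul1r.
  have [s sk] : exists s, e * 3 / 8 <= `|wsum (P k) (w k) (C s)|.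
    apply: contrapT => /forallNP Cs.
    have := Cs true; have := Cs false; rewrite -!Ck => /negP + /negP.
    rewrite -!ltNge => Cf Ct.
    have := HN k Nk; rewrite ger0_norm ?wsum_ge0 // => Im.
    move: ek; rewrite ger0_norm ?wsum_ge0 //.
    have : abs k A <= abs k (`I_m `|` (C true `|` C false)).
      apply: le_wsum => // x xP Ax; have [mx|xm] := leqP m x; last by left.
      by right; case w0 : (0 <= w k x); [left|right].
    have := le_wsumU (P k) `I_m (C true `|` C false) (fun x => normr_ge0 (w k x)).
    have := le_wsumU (P k) (C true) (C false) (fun x => normr_ge0 (w k x)).
    lra.
  exists k, (C s), (maxn m.+1 m'); split => //.
  - by rewrite leq_max leqnn.
  - by move=> x [_ mx xP _]; rewrite mx /= leq_max Pm' ?orbT.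
  - split => //; first by move=> x [].
      by move=> x xP; rewrite leq_max Pm' ?orbT.
    by have := HN k Nk; rewrite ger0_norm ?wsum_ge0.
have IB : I (\bigcup_j B_ j).
  by apply: ideal_sub IA => x [j _]; have [BA _ _ _] := HQ j; exact: BA.
have [N HN] := (cvgn0P _).1 (wsum_cvg0 IB) _ e80.
have := HN (k_ N) (jk N).
have [BA PN IN BN] := HQ N.
(* Later humps lie beyond the support [P (k_ N)] and earlier ones below [m_ N], so the other humps
   contribute at most the variation below [m_ N]. *)
suff : `|wsum (P (k_ N)) (w (k_ N)) (\bigcup_j B_ j) -
    wsum (P (k_ N)) (w (k_ N)) (B_ N)| <= abs (k_ N) `I_(m_ N).
  have := lerB_normD (wsum (P (k_ N)) (w (k_ N)) (B_ N))
    (wsum (P (k_ N)) (w (k_ N)) (\bigcup_j B_ j) -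
    wsum (P (k_ N)) (w (k_ N)) (B_ N)).
  by rewrite [X in _ <= `|X|]addrC subrK; lra.
rewrite /wsum (bigID (fun x => x \in B_ N)) /=.
rewrite (eq_bigl (fun x => x \in B_ N)); last first.
  by move=> x; apply/andP/idP => [[]//|xB]; split => //; rewrite inE;
    exists N => //; exact: set_mem.
rewrite addrAC subrr add0r; apply: le_trans (ler_norm_sum _ _ _) _.
apply: le_trans (_ : abs (k_ N) (\bigcup_j B_ j `\` B_ N) <= _).
  by rewrite /wsum (eq_bigl (fun x => x \in \bigcup_j B_ j `\` B_ N)) // => x;
    rewrite in_setD.
apply: le_wsum => // x /PN xN [[j _ Bjx] nBx].
have /andP[jx xj] := B_m j x Bjx.
have [Nj|jN|Nj] := ltngtP N j; last by rewrite Nj in nBx.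
- by have := m_le _ _ Nj; rewrite leqNgt (leq_ltn_trans jx).
- by rewrite /=; exact: leq_trans xj (m_le _ _ jN).
Qed.

End Schur.
End WeightedSums.

(** * Nonnegative masses on omega from a failure of the Nikodym property *)

Section VanishingMasses.
Variables (R : realType) (I : ideal).

Definition vanishing_masses (P : nat -> seq nat) (w : nat -> nat -> R) : Prop :=
  (forall k x, 0 <= w k x) /\
  (forall A, I A -> wsum (P k) (w k) A @[k --> \oo] --> 0).

Definition omega_support (mu : fs_measure R (Nspace I)) : seq nat :=
  pmap id (fs_dom mu : seq (option nat)).

Definition omega_coef (mu : fs_measure R (Nspace I)) (x : nat) : R :=
  fs_coef mu (Some x).

Lemma fs_eval_image_Some (mu : fs_measure R (Nspace I)) (A : set nat) :
  fs_eval mu (Some @` A) = wsum (omega_support mu) (omega_coef mu) A.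
Proof.
rewrite /fs_eval /wsum /omega_support [RHS]big_mkcond big_pmap /=.
apply: eq_bigr => -[x|] _ /=; rewrite indicE; last first.
  by rewrite memNset ?mulr0 // => -[].
rewrite (_ : (Some x \in Some @` A) = (x \in A)).
  by case: ifP; rewrite ?mulr1 ?mulr0.
apply/idP/idP; rewrite !inE; last by exists x.
by case=> y Ay [<-].
Qed.

(** The coefficient at p is the value on the whole space minus the total on omega, so it costs one
    more copy of the variation on omega. *)
Lemma fs_norm_le_omega (mu : fs_measure R (Nspace I)) :
  fs_norm mu <= `|fs_eval mu setT| +
    2 * \sum_(x <- omega_support mu) `|omega_coef mu x|.
Proof.
(* As a filtered sum, c is the mass at p whether or not p is in the domain. *)
pose c := \sum_(x <- fs_dom mu | x == None :> option nat) fs_coef mu x.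
have split_dom (F : Nspace I -> R) : \sum_(x <- fs_dom mu) F x =
    \sum_(x <- fs_dom mu | x == None :> option nat) F x +
    \sum_(x <- omega_support mu) F (Some x).
  rewrite (bigID (fun x => x == None :> option nat)) /=; congr (_ + _).
  by rewrite /omega_support big_pmap [LHS]big_mkcond; apply: eq_bigr => -[].
have normc : `|c| = \sum_(x <- fs_dom mu | x == None :> option nat) `|fs_coef mu x|.
  rewrite /c (eq_bigr (fun=> fs_coef mu None)); last by move=> x /eqP ->.
  rewrite [RHS](eq_bigr (fun=> `|fs_coef mu None|)); last by move=> x /eqP ->.
  by rewrite !big_const_seq !iter_addr !addr0 normrMn.
rewrite /fs_norm split_dom -normc.
have -> : fs_eval mu setT = c + \sum_(x <- omega_support mu) omega_coef mu x.
  by rewrite /fs_eval -split_dom; apply: eq_bigr => x _; rewrite indicT mulr1.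
have := ler_norm_sum (omega_support mu) (omega_coef mu) predT.
set b := \sum_(x <- _) omega_coef mu x; set a := \sum_(x <- _) `|_|.
by have := lerB_normD c b; rewrite /omega_coef; lra.
Qed.

(** The whole space is clopen, so unbounded norms force unbounded variations on omega. These vanish
    on I by [wsum_norm_cvg0], and a subsequence grows as fast as M asks. *)
Lemma not_nikodym_vanishing_masses : ~ fs_nikodym R (Nspace I) ->
  forall M : nat -> nat, exists P w, vanishing_masses P w /\
    forall k, (M k)%:R <= wsum (P k) (w k) setT.
Proof.
move=> /existsNP[mu /not_implyP[mu0 /forallNP unb]] M.
pose P n := omega_support (mu n); pose w n := omega_coef (mu n).
have cvgw := wsum_norm_cvg0 (P := P) (w := w) (I := I).
have {}cvgw A : I A -> wsum (P n) (fun x => `|w n x|) A @[n --> \oo] --> 0.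
  apply: cvgw => B /clopen_image_Some/mu0/cvgn0P cB; apply/cvgn0P => e /cB[N HN].
  by exists N => n /HN; rewrite fs_eval_image_Some.
have big (C : R) N : exists2 n, (N <= n)%N & C <= fs_norm (mu n).
  (* Exceeding the sum of the first N norms forces n >= N. *)
  have /existsNP[n /negP] := unb (Num.max C (\sum_(n < N) fs_norm (mu n))).
  rewrite -ltNge gt_max => /andP[Cn Nn]; exists n; last exact: ltW.
  rewrite leqNgt; apply/negP => nN; move: Nn; apply/negP; rewrite -leNgt.
  rewrite (bigD1 (Ordinal nN)) //= lerDl sumr_ge0 // => i _.
  by rewrite sumr_ge0.
have sub k : exists n, (k <= n)%N /\
    (M k)%:R <= wsum (P n) (fun x => `|w n x|) setT.
  have [N HN] := (cvgn0P _).1 (mu0 _ clopenT) 1 ltr01.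
  have [n] := big (1 + 2 * (M k)%:R) (maxn k N).
  rewrite geq_max => /andP[kn /HN n1] Mn; exists n; split => //.
  by rewrite wsumT; have := fs_norm_le_omega (mu n); rewrite /w /P; lra.
have [s Hs] := choice sub.
exists (P \o s), (fun k x => `|w (s k) x|); split; last by move=> k; have [] := Hs k.
split=> // A /cvgw /cvgn0P cA; apply/cvgn0P => e /cA[N HN].
by exists N => k Nk; apply: HN; have [ks _] := Hs k; exact: leq_trans ks.
Qed.

End VanishingMasses.

(** * Katetov reduction of an ideal in AN to a block ideal *)

Section KatetovFromAN.
Variables (R : realType) (I : ideal) (P : nat -> seq nat) (w : nat -> nat -> R).
Variable g : nat -> nat.
Hypothesis vanishPw : vanishing_masses I P w.
Hypothesis massPw : forall k, (2 * k)%:R <= wsum (P k) (w k) setT.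
Hypothesis sizeP : le_star (fun k => size (P k)) g.

(** The number of block points to be sent to x: the weight of x divided by the mass 1/(k
    [width g k]) of one block point, rounded down so that the image measure stays below [w k]. *)
Definition copies (k x : nat) : nat :=
  Num.truncn (w k x * (k * width g k)%:R).

Definition copy_seq (k : nat) : seq nat :=
  flatten [seq nseq (copies k x) x | x <- P k].

Lemma count_copy_seq k (a : pred nat) :
  count a (copy_seq k) = (\sum_(x <- P k | a x) copies k x)%N.
Proof.
rewrite count_flatten -map_comp sumnE big_map [RHS]big_mkcond /=.
by apply: eq_bigr => x _; rewrite count_nseq; case: (a x); rewrite ?mul1n.
Qed.

Lemma count_copy_seq_le k (A : set nat) :
  (count (fun x => x \in A) (copy_seq k))%:R <=
  (k * width g k)%:R * wsum (P k) (w k) A.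
Proof.
have [w0 _] := vanishPw.
rewrite count_copy_seq natr_sum mulr_sumr; apply: ler_sum => x _.
by rewrite mulrC truncn_le mulr_ge0.
Qed.

(** Mass 2k accounts for 2k^2 [width g k] copies, and rounding loses at most one per support point,
    hence at most [width g k] in all. *)
Lemma size_copy_seq k : (0 < k)%N -> (size (P k) <= width g k)%N ->
  (k ^ 2 * width g k <= size (copy_seq k))%N.
Proof.
move=> k0 Pk; rewrite -(@ler_nat R) -count_predT count_copy_seq natr_sum.
have lb : wsum (P k) (w k) setT * (k * width g k)%:R - (size (P k))%:R <=
    \sum_(x <- P k) (copies k x)%:R.
  rewrite wsumT mulr_suml -[size _]sum1_size natr_sum -sumrB; apply: ler_sum => x _.
  by rewrite lerBlDr natr1 ltW // truncnS_gt.
apply: le_trans lb; rewrite lerBrDr -natrD.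
apply: le_trans (_ : (2 * k)%:R * (k * width g k)%:R <= _); last first.
  by rewrite ler_wpM2r.
by rewrite -natrM ler_nat; nia.
Qed.

Definition spread_map (x : nat) : nat :=
  if (choice.unpickle x : option (nat * nat)) is Some nj
  then nth 0%N (copy_seq nj.1) nj.2 else 0%N.

Lemma spread_map_block k : (k ^ 2 * width g k <= size (copy_seq k))%N ->
  map spread_map (block g k) = take (k ^ 2 * width g k) (copy_seq k).
Proof.
move=> kw; rewrite -map_comp -[copy_seq k in RHS](mkseq_nth 0%N) /mkseq -map_take.
rewrite take_iota (minn_idPl kw); apply: eq_map => j /=.
by rewrite /spread_map choice.pickleK.
Qed.

Lemma katetov_le_block_ideal : katetov_le I (block_ideal g).
Proof.
have [w0 cvgw] := vanishPw; have [m Hm] := finite_nat_bound id sizeP.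
exists spread_map => A /cvgw/cvgn0P cA e.
have [N HN] := cA e.+1%:R^-1 ltac:(by []).
exists (maxn m (maxn N 1)) => k; rewrite !geq_max => /and3P[mk /HN Nk k0].
have Pk : (size (P k) <= width g k)%N.
  apply: leq_trans (le_width g (leqnn k)).
  by apply: contrapT => /(Hm k); rewrite ltnNge mk.
rewrite -(@ler_nat R) natrM.
(* Block k is mapped onto an initial segment of [copy_seq k], so the preimage of A has at most as
   many block points as the list has entries in A. *)
have cA1 : (block_count g k (spread_map @^-1` A))%:R <=
    (k * width g k)%:R * wsum (P k) (w k) A.
  apply: le_trans (count_copy_seq_le k A); rewrite ler_nat.
  rewrite -(cat_take_drop (k ^ 2 * width g k) (copy_seq k)).
  rewrite -spread_map_block ?size_copy_seq // count_cat count_map.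
  apply: leq_trans (leq_addr _ _); apply: sub_count => x /=.
  by rewrite !inE.
move: Nk; rewrite ger0_norm ?wsum_ge0 // -[ltRHS]mul1r ltr_pdivlMr // => Nk.
apply: le_trans (_ : e.+1%:R * ((k * width g k)%:R * wsum (P k) (w k) A) <= _).
  by apply: ler_pM => //; rewrite ler_nat.
by rewrite mulrCA ler_piMr // ltW // mulrC.
Qed.

End KatetovFromAN.

(** * Bounding f by support sizes, given a Katetov reduction of $I_f$ *)

Lemma le_wsum_bigcup (R : realType) (s : seq nat) (v : nat -> R) (T : finType)
    (F : T -> set nat) : (forall x, 0 <= v x) ->
  wsum s v (\bigcup_t F t) <= \sum_t wsum s v (F t).
Proof.
move=> v0; rewrite /wsum; under [leRHS]eq_bigr do rewrite big_mkcond /=.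
rewrite exchange_big big_mkcond /=; apply: ler_sum => x _.
case: ifP => [/set_mem[t _ Ft]|_]; last by apply: sumr_ge0 => t _; case: ifP.
rewrite (bigD1 t) //= mem_set // lerDl; apply: sumr_ge0 => i _; by case: ifP.
Qed.

Section BoundFromKatetov.
Variables (R : realType) (J : ideal) (P : nat -> seq nat) (w : nat -> nat -> R).
Variables (f phi : nat -> nat).
Hypothesis vanishPw : vanishing_masses J P w.
Hypothesis massPw : forall k,
  (2 + k.+1 * (k ^ 2).+1)%:R <= wsum (P k) (w k) setT.
Hypothesis phiJ : forall A, block_ideal f A -> J (phi @^-1` A).

Local Notation push k A := (wsum (P k) (w k) (phi @^-1` A)).

Definition block_offset (x : nat) : nat :=
  if (choice.unpickle x : option (nat * nat)) is Some nj then nj.2 else 0%N.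

(** Dividing offsets by [width f n] cuts block n into n^2 runs of [width f n] consecutive
    offsets. *)
Definition piece (n i : nat) : set nat :=
  [set x | x \in block f n /\ (block_offset x %/ width f n)%N = i].

Lemma piece_index n i x : piece n i x -> block_index x = n.
Proof. by case=> /mem_block_index. Qed.

Lemma block_count_piece n i n' : (block_count f n' (piece n i) <= width f n')%N.
Proof.
have [->|nn'] := eqVneq n' n; last first.
  rewrite block_count0 // => x /piece_index -> nn.
  by rewrite nn eqxx in nn'.
apply: leq_trans (_ : size [seq choice.pickle (n, j) | j : nat <-
  iota (i * width f n) (width f n)] <= _)%N; last by rewrite size_map size_iota.
apply: block_count_le_size => _ [/mapP[j _ ->] <-] _; apply/mapP; exists j => //.
rewrite mem_iota /block_offset choice.pickleK /= leq_divM /=.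
by rewrite addnC -mulSn ltn_ceil.
Qed.

(** Pigeonhole: the image mass splits over the points outside all blocks from m on, the points
    beyond block k, and the pieces of blocks m to k. If each of these had mass below 1, the total
    would contradict [massPw]. *)
Lemma push_hump m k :
  (m <= k)%N -> (size (P k) <= f k)%N ->
  push k [set x | forall n, (m <= n)%N -> x \notin block f n] < 1 ->
  exists B m', [/\ (m < m')%N, forall x, B x -> (m <= block_index x < m')%N,
    forall n, (block_count f n B <= width f n)%N & 1 <= push k B].
Proof.
have [w0 _] := vanishPw.
move=> mk Pf low; apply: contrapT => noB.
have small B : finite_set B -> (forall x, B x -> (m <= block_index x)%N) ->
    (forall n, (block_count f n B <= width f n)%N) -> push k B < 1.
  move=> /(finite_nat_bound block_index)[m' Bm'] mB cB.
  rewrite ltNge; apply/negP => B1; apply: noB; exists B, (maxn m.+1 m').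
  split => // [|x Bx]; first by rewrite leq_max leqnn.
  by rewrite mB //= leq_max Bm' ?orbT.
(* H has at most [size (P k)] points, hence at most [f k <= width f n] in any block n > k, and none
   in earlier blocks. *)
pose H := [set x | x \in map phi (P k) /\ (k < block_index x)%N].
have smallH : push k H < 1.
  apply: small => [|x [_ /ltnW kx]|n].
  - by apply: sub_finite_set (finite_seq (map phi (P k))) => x [].
  - exact: leq_trans kx.
  - have [nk|kn] := leqP n k.
      by rewrite block_count0 // => x [_ + xn]; rewrite xn ltnNge nk.
    apply: leq_trans (_ : size (map phi (P k)) <= _)%N.
      by apply: block_count_le_size => x [].
    by rewrite size_map (leq_trans Pf) // le_width // ltnW.
pose T := ('I_k.+1 * 'I_(k ^ 2).+1)%type.
pose F (t : T) := [set x | piece t.1 t.2 x /\ (m <= t.1)%N].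
have smallF t : push k (F t) < 1.
  apply: small => [|x [/piece_index -> //]|n].
    by apply: sub_finite_set (finite_seq (block f t.1)) => x [[]].
  by apply: leq_trans (block_count_piece t.1 t.2 n); apply: sub_block_count => x [].
have : wsum (P k) (w k) setT <=
    push k [set x | forall n, (m <= n)%N -> x \notin block f n] +
    (push k H + \sum_t push k (F t)).
  apply: le_trans (lerD (lexx _) (lerD (lexx _) (le_wsum_bigcup _ _ _))) => //.
  apply: le_trans (lerD (lexx _) (le_wsumU _ _ _ _)) => //.
  apply: le_trans (le_wsumU _ _ _ _) => //.
  apply: le_wsum => // x xP _.
  have [[n mn xn]|nox] := pselect (exists2 n, (m <= n)%N & phi x \in block f n);
    last by left => n mn; apply/negP => xn; apply: nox; exists n.
  right; have [kn|nk] := ltnP k n.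
    by left; split; [exact: map_f|rewrite (mem_block_index xn)].
  have on : (block_offset (phi x) %/ width f n < (k ^ 2).+1)%N.
    case/mapP: xn => j; rewrite mem_iota add0n => /andP[_ jn] ->.
    have jw : (j %/ width f n < n ^ 2)%N by rewrite ltn_divLR.
    by rewrite /block_offset choice.pickleK /= ltnS (leq_trans (ltnW jw)) // leq_exp2r.
  by right; exists (inord n, Ordinal on) => //=; rewrite /F /= inordK.
have sumF : \sum_t push k (F t) <= (k.+1 * (k ^ 2).+1)%:R.
  apply: le_trans (_ : \sum_(t : T) 1 <= _); first by apply: ler_sum => t _; exact: ltW.
  by rewrite sumr_const card_prod !card_ord.
by have := massPw k; rewrite natrD; lra.
Qed.

Lemma le_star_size : le_star f (fun k => size (P k)).
Proof.
have [w0 cvgw] := vanishPw; apply: contrapT => inf.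
have large N : exists2 k, (N <= k)%N & (size (P k) <= f k)%N.
  apply: contrapT => noN; apply: inf; apply: (@sub_finite_set _ _ `I_N) => //.
  move=> k /negP; rewrite -ltnNge => Pf; rewrite /= ltnNge; apply/negP => Nk.
  by apply: noN; exists k => //; exact: ltnW.
have [m|m_ [k_ [B_ [jk m_le B_m HQ]]]] := @gliding_hump block_index
    (fun _ k B _ => (forall n, (block_count f n B <= width f n)%N) /\ 1 <= push k B).
  (* Z misses all blocks from m on, so it is null and its image mass drops below 1; this pushes the
     next hump past m. *)
  pose Z := [set x | forall n, (m <= n)%N -> x \notin block f n].
  have nZ : block_null f Z by apply: (@block_null_low _ m) => n x mn; exact.
  have [N HN] := (cvgn0P _).1 (cvgw _ (phiJ nZ)) 1 ltr01.
  have [k] := large (maxn m N); rewrite geq_max => /andP[mk /HN Nk] Pk.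
  have Z1 : push k Z < 1 by exact: le_lt_trans (ler_norm _) Nk.
  by have [B [m' [mm' mB cB B1]]] := push_hump mk Pk Z1; exists k, B, m'; split.
(* The block ranges of the humps are disjoint, so each block meets at most one hump and the bound
   [width f n] survives the union. *)
have nB : block_null f (\bigcup_j B_ j).
  apply: block_null_small => n.
  have [[j jn]|noj] := pselect (exists j, (m_ j <= n < m_ j.+1)%N); last first.
    rewrite block_count0 // => x [j _ /B_m jx] xn.
    by apply: noj; exists j; rewrite -xn.
  have [cB _] := HQ j; apply: leq_trans (cB n).
  rewrite [leqLHS](_ : _ = block_count f n (B_ j)) //; apply: eq_in_count => x xn.
  apply/idP/idP; rewrite !inE; last by exists j.
  case=> i _ Bix.
  have [ij|ji|<-//] := ltngtP i j; have := B_m _ _ Bix;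
    rewrite (mem_block_index xn).
  - by have := m_le _ _ ij; lia.
  - by have := m_le _ _ ji; lia.
have [N HN] := (cvgn0P _).1 (cvgw _ (phiJ nB)) 1 ltr01.
have [_ B1] := HQ N; have := HN _ (jk N).
apply/negP; rewrite -leNgt; apply: le_trans (ler_norm _); apply: le_trans B1 _.
by apply: le_wsum => // x _ BN; exists N.
Qed.

End BoundFromKatetov.

(** * The two Tukey reductions *)

Theorem theoremH (R : realType) :
  tukey_equiv (AN_preorder R) baire_preorder.
Proof.
have masses M (I : AN R) := not_nikodym_vanishing_masses (svalP I) M.
split.
  have [P HP] := choice (masses (fun k => 2 * k)%N).
  (* Ideals go to their support sizes, and [block_ideal g] bounds all those with sizes below g; in
     the other direction f goes to [block_ideal f], and the support sizes of J are the bound. *)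
  exists (fun I k => size (P I k)) => g.
  exists (exist _ (block_ideal g) (@block_ideal_AN R g)) => I Pg.
  have [w [vanish mass]] := HP I.
  exact: katetov_le_block_ideal vanish mass Pg.
exists (fun f => exist _ (block_ideal f) (@block_ideal_AN R f)) => J.
have [P [w [vanish mass]]] := masses (fun k => 2 + k.+1 * (k ^ 2).+1)%N J.
exists (fun k => size (P k)) => f [phi phiJ].
exact: le_star_size vanish mass phiJ.
Qed.
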